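(* Let $X$ be a Banach space. (i) $X$ is reflexive if and only if $\mathcal{AK}(B_X)\sim\{0\}$. (ii) $X$ is SWCG and non-reflexive if and only if $\mathcal{AK}(B_X)\sim\omega$.
   Context: Banach spaces are real; $B_X$ is the closed unit ball of $X$. $X$ is strongly weakly compactly generated (SWCG) if there exists a weakly compact set $K\subseteq X$ such that for every $\varepsilon>0$ and every weakly compact set $L\subseteq X$ there is $n<\omega$ such that $L\subseteq nK+\varepsilon B_X$. An asymptotic structure is a set $P$ with a family of binary relations $\{\le_t\}_{t>0}$ such that: $p\le_t p$ for all $p\in P$, $t>0$; if $t<s$ and $p_1\le_t p_2$ then $p_1\le_s p_2$; and $\bigcap_{t>0}\le_t$ is a partial order on $P$. Every poset $(P,\le)$ is viewed as an asymptotic structure by setting $\le_t:=\le$ for all $t>0$. For asymptotic structures $P,Q$, a Tukey reduction $P\Rightarrow Q$ is a family of functions $\{f_\varepsilon:P\to Q\}_{\varepsilon>0}$ such that for every $\varepsilon>0$ there is $\delta>0$ with the following property: for every $q_0\in Q$ there is $p_0\in P$ such that $p\le_\varepsilon p_0$ whenever $p\in P$ and $f_\varepsilon(p)\le_\delta q_0$. Write $P\preceq Q$ if such a reduction exists, and $P\sim Q$ if $P\preceq Q$ and $Q\preceq P$. $\mathcal{AK}(B_X)$ is the asymptotic structure whose underlying set is the family of all weakly compact subsets of $B_X$, with $K\le_t L$ if and only if $K\subseteq L+tB_X$. $\{0\}$ is a singleton poset and $\omega$ has its natural order. *)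

(* Defs.v *)
From HB Require Import structures.
From mathcomp Require Import all_boot all_order all_algebra.
From mathcomp Require Import all_classical all_reals all_analysis.
From mathcomp Require Import ring lra.
Set Implicit Arguments.
Unset Strict Implicit.
Unset Printing Implicit Defensive.
Import Order.TTheory GRing.Theory Num.Theory.
Import numFieldNormedType.Exports.
Local Open Scope classical_set_scope.
Local Open Scope ring_scope.

Section dual_space.
Context {R : realType} {X : normedModType R}.

Definition clin : {pred (X -> R^o)} :=
  [pred f : X -> R^o | `[< linear f /\ continuous f >]].

Record dual := Dual { dual_fun :> X -> R^o; dual_funP : dual_fun \in clin }.

HB.instance Definition _ := [isSub for dual_fun].
HB.instance Definition _ := [Choice of dual by <:].

Lemma clin_submod_closed : submod_closed clin.
Proof.
split=> [|a f g /asboolP[lf cf] /asboolP[lg cg]]; apply/asboolP; split.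
- by move=> a x y; rewrite /GRing.zero/= scaler0 addr0.
- exact: cst_continuous.
- move=> b x y; rewrite !fctE lf lg /=.
  by rewrite /GRing.scale/=; ring.
- move=> x; apply: continuousD; last exact: cg.
  exact: (@cvgZl_tmp _ R^o _ _ _ a f (f x) (cf x)).
Qed.

HB.instance Definition _ :=
  GRing.isSubmodClosed.Build R (X -> R^o) clin clin_submod_closed.
HB.instance Definition _ := [SubChoice_isSubLmodule of dual by <:].

Lemma dual_linear (f : dual) : linear (f : X -> R^o).
Proof. by case: f => f /= /asboolP[]. Qed.

HB.instance Definition _ (f : dual) :=
  @GRing.isLinear.Build R X R^o *:%R (f : X -> R^o) (dual_linear f).

Lemma dual_continuous (f : dual) : continuous (f : X -> R^o).
Proof. by case: f => f /= /asboolP[]. Qed.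

Lemma dual_bounded (f : dual) :
  exists2 M : R, 0 < M & forall x : X, `|f x| <= M * `|x|.
Proof.
have /linear_bounded_continuous/linear_boundedP/pinfty_ex_gt0[M M0 fM] :=
  @dual_continuous f.
by exists M.
Qed.

Definition dual_norm (f : dual) : R :=
  sup [set `|f x : R| | x in closed_ball (0 : X) 1].

Lemma closed_unit_ballE : closed_ball (0 : X) 1 = [set x | `|x| <= 1].
Proof.
rewrite closed_ballE//; apply/seteqP; split=> x; rewrite /closed_ball_/=;
  by rewrite sub0r normrN.
Qed.

Lemma closed_unit_ballP (x : X) : closed_ball (0 : X) 1 x <-> `|x| <= 1.
Proof. by rewrite closed_unit_ballE. Qed.

Lemma has_sup_dual_norm (f : dual) :
  has_sup [set `|f x : R| | x in closed_ball (0 : X) 1].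
Proof.
split; first by exists `|f 0|, 0 => //; rewrite closed_unit_ballE /= normr0.
have [M M0 fM] := dual_bounded f.
exists M => _ [x + <-]; rewrite closed_unit_ballE /= => x1.
by rewrite (le_trans (fM x))// ler_piMr// ltW.
Qed.

Lemma dual_norm_ub (f : dual) (x : X) : `|x| <= 1 -> `|f x| <= dual_norm f.
Proof.
move=> x1; apply: sup_upper_bound; first exact: has_sup_dual_norm.
by exists x => //; rewrite closed_unit_ballE.
Qed.

Lemma dual_norm_le (f : dual) (M : R) :
  (forall x, `|x| <= 1 -> `|f x| <= M) -> dual_norm f <= M.
Proof.
move=> fM; apply: ge_sup; first by have [] := has_sup_dual_norm f.
by move=> _ [x + <-]; rewrite closed_unit_ballE /=; exact: fM.
Qed.

Lemma dual_norm_ge0 (f : dual) : 0 <= dual_norm f.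
Proof. by rewrite (le_trans (normr_ge0 (f 0)))// dual_norm_ub// normr0. Qed.

Lemma dual_le_norm (f : dual) (x : X) : `|f x| <= dual_norm f * `|x|.
Proof.
have [->|x0] := eqVneq x 0; first by rewrite linear0 !normr0 mulr0.
have nx : 0 < `|x| by rewrite normr_gt0.
rewrite -ler_pdivrMr//.
have := @dual_norm_ub f (`|x|^-1 *: x).
rewrite linearZ/= !normrZ normfV normr_id mulVf ?gt_eqF// => /(_ (lexx _)).
by rewrite mulrC.
Qed.

Lemma dual_normD (f g : dual) : dual_norm (f + g) <= dual_norm f + dual_norm g.
Proof.
apply: dual_norm_le => x x1.
by rewrite (le_trans (ler_normD _ _))// lerD// dual_norm_ub.
Qed.

Lemma dual_normZ (a : R) (f : dual) : dual_norm (a *: f) = `|a| * dual_norm f.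
Proof.
have H (b : R) (g : dual) : dual_norm (b *: g) <= `|b| * dual_norm g.
  by apply: dual_norm_le => x x1; rewrite normrM ler_wpM2l// dual_norm_ub.
apply/eqP; rewrite eq_le H/=.
have [->|a0] := eqVneq a 0; first by rewrite normr0 mul0r dual_norm_ge0.
rewrite -ler_pdivlMl ?normr_gt0// -normfV.
by rewrite -[in leLHS](scalerK a0 f).
Qed.

Lemma dual_norm0_eq0 (f : dual) : dual_norm f = 0 -> f = 0.
Proof.
move=> f0; apply/val_inj/funext => x /=.
by apply/normr0_eq0/le_anti; rewrite normr_ge0 (le_trans (dual_le_norm f x))//
  f0 mul0r.
Qed.

HB.instance Definition _ :=
  Lmodule_isNormed.Build R dual dual_normD dual_normZ dual_norm0_eq0.

End dual_space.
Arguments dual {R} X.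

Section weak.
Context {R : realType}.

(* The canonical embedding [x |-> (f |-> f x)] of [X] into its bidual is onto *)
Definition reflexive_space (X : normedModType R) : Prop :=
  forall phi : dual (dual X), exists x : X, forall f : dual X, phi f = f x.

Definition weak_space (X : normedModType R) : topologicalType :=
  @sup_topology X (dual X) (fun f => Topological.class (initial_topology f)).

Definition weakly_compact (X : normedModType R) (K : set X) : Prop :=
  compact (K : set (weak_space X)).

Definition fatten (X : normedModType R) (A : set X) (t : R) : set X :=
  [set a + t *: b | a in A & b in closed_ball (0 : X) 1].

Definition SWCG (X : normedModType R) : Prop :=
  exists2 K : set X, weakly_compact K &
    forall e : R, 0 < e -> forall L : set X, weakly_compact L ->
      exists n : nat, L `<=` fatten [set n%:R *: x | x in K] e.

End weak.

Section separation.
Context {R : realType} {X : normedModType R}.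

(* Graphs of linear maps on subspaces that are bounded by the norm; a graph is
   single-valued because [(0, r) \in G] and [(0, - r) \in G] force [r = 0]. *)
Let good (z : X) (G : set (X * R)) : Prop :=
  [/\ forall p, G p -> G (z, `|z|),
      forall (a : R) p q, G p -> G q -> G (a *: p.1 + q.1, a * p.2 + q.2) &
      forall p, G p -> p.2 <= `|p.1|].

Let good_inj z G x r s : good z G -> G (x, r) -> G (x, s) -> r = s.
Proof.
move=> [_ lG dG] xr xs; apply/le_anti.
have := dG _ (lG (-1) _ _ xr xs); have := dG _ (lG (-1) _ _ xs xr).
by rewrite /= scaleN1r addNr normr0; lra.
Qed.

Let good_max z : exists A, good z A /\ forall B, A `<` B -> ~ good z B.
Proof.
apply: Zorn_bigcup => F FG totF; split.
- by move=> p [A FA Ap]; exists A => //; have [+ _ _] := FG _ FA; apply; exact: Ap.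
- move=> a p q [A FA Ap] [B FB Bq].
  have [AB|BA] := totF _ _ FA FB.
    by exists B => //; have [_ + _] := FG _ FB; apply => //; exact: AB.
  by exists A => //; have [_ + _] := FG _ FA; apply => //; exact: BA.
- by move=> p [A FA Ap]; have [_ _ +] := FG _ FA; apply.
Qed.

Let good_line z : good z [set (a *: z, a * `|z|) | a in [set: R]].
Proof.
split.
- by move=> _ _; exists 1 => //; rewrite scale1r mul1r.
- move=> a _ _ [b _ <-] [c _ <-] /=; exists (a * b + c) => //.
  by rewrite scalerDl scalerA mulrDl mulrA.
- by move=> _ [a _ <-] /=; rewrite normrZ ler_wpM2r// ler_norm.
Qed.

Let good_extend z G x : good z G -> G !=set0 ->
  exists2 H, good z H & G `<=` H /\ exists r, H (x, r).
Proof.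
move=> [zG lG dG] [p0 Gp0]; have Gz := zG _ Gp0.
have G00 : G (0, 0).
  have := lG (-1) _ _ Gz Gz; by rewrite /= scaleN1r mulN1r !addNr.
have GZ a p : G p -> G (a *: p.1, a * p.2).
  by move=> Gp; have := lG a _ _ Gp G00; rewrite /= !addr0.
pose E := [set p.2 - `|p.1 - x| | p in G].
have leE p q : G p -> G q -> p.2 - `|p.1 - x| <= `|q.1 + x| - q.2.
  move=> Gp Gq; have := dG _ (lG 1 _ _ Gp Gq); rewrite /= scale1r mul1r.
  have := ler_normD (p.1 - x) (q.1 + x).
  by rewrite addrACA addNr addr0; lra.
have supE : has_sup E.
  split; first by exists (0 - `|0 - x|), (0, 0).
  by exists (`|0 + x| - 0) => _ [p Gp <-]; exact: (leE p (0, 0)).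
pose c := sup E.
have lec p : G p -> p.2 - `|p.1 - x| <= c.
  by move=> Gp; apply: sup_upper_bound => //; exists p.
have cle q : G q -> c <= `|q.1 + x| - q.2.
  move=> Gq; apply: ge_sup; first by case: supE.
  by move=> _ [p Gp <-]; exact: leE.
exists [set (p.1 + t *: x, p.2 + t * c) | p in G & t in [set: R]]; last first.
  split; last by exists c, (0, 0) => //; exists 1 => //=; rewrite scale1r mul1r !add0r.
  by move=> [u r] Gur; exists (u, r) => //; exists 0 => //=; rewrite scale0r mul0r !addr0.
split.
- by move=> _ _; exists (z, `|z|) => //; exists 0 => //=; rewrite scale0r mul0r !addr0.
- move=> a _ _ [p Gp [t _ <-]] [q Gq [s _ <-]] /=.
  exists (a *: p.1 + q.1, a * p.2 + q.2); first exact: lG.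
  exists (a * t + s) => //=; congr pair; last by ring.
  by rewrite scalerDr scalerDl scalerA addrACA.
- move=> _ [p Gp [t _ <-]] /=.
  have [t0|t0|->] := ltgtP t 0; last by rewrite scale0r mul0r !addr0; exact: dG.
  + have t0' : 0 < - t by rewrite oppr_gt0.
    have := lec _ (GZ (- t)^-1 _ Gp) => /=.
    rewrite -(ler_pM2l t0') mulrBr mulrA mulfV ?gt_eqF// mul1r.
    rewrite -[X in _ - X * _](gtr0_norm t0') -normrZ scalerBr scalerA.
    by rewrite mulfV ?gt_eqF// scale1r scaleNr opprK; lra.
  + have := cle _ (GZ t^-1 _ Gp) => /=.
    rewrite -(ler_pM2l t0) mulrBr mulrA mulfV ?gt_eqF// mul1r.
    rewrite -[X in _ <= X * _ - _](gtr0_norm t0) -normrZ scalerDr scalerA.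
    by rewrite mulfV ?gt_eqF// scale1r; lra.
Qed.

Lemma hahn_banach_norming (z : X) :
  exists2 f : dual X, forall x, `|f x| <= `|x| & f z = `|z|.
Proof.
have [A [gA maxA]] := good_max z.
have A0 : A !=set0.
  apply: contrapT => nA; apply: (maxA _ _ (good_line z)); split.
    by move=> p Ap; exfalso; apply: nA; exists p.
  by move=> /(_ (1 *: z, 1 * `|z|))h; apply: nA; eexists; apply: h; exists 1.
have totA x : exists r, A (x, r).
  have [H gH [AH [r Hr]]] := good_extend x gA A0.
  apply: contrapT => nr; apply: (maxA H _ gH); split=> // HA.
  by apply: nr; exists r; exact: HA.
have [F AF] := choice totA.
have [zA lA dA] := gA.
have linF : linear (F : X -> R^o).
  by move=> a x y; apply: (good_inj gA (AF _)); exact: (lA a _ _ (AF x) (AF y)).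
have Fle x : `|F x| <= `|x|.
  rewrite ler_norml -lerNl; have := dA _ (AF x); rewrite /= => ->; rewrite andbT.
  have <- : F (- x) = - F x.
    have /= h := lA (-1) _ _ (AF x) (lA (-1) _ _ (AF x) (AF x)).
    rewrite !scaleN1r !mulN1r !addNr !addr0 in h.
    exact: (good_inj gA (AF _) h).
  by have := dA _ (AF (- x)); rewrite /= normrN.
pose L := GRing.isLinear.Build R X R^o *:%R F linF.
pose F' : {linear X -> R^o} := HB.pack (F : X -> R^o) L.
have cF : continuous (F : X -> R^o).
  apply: (@bounded_linear_continuous R X R^o F').
  apply/linear_boundedP; near=> r => x.
  by rewrite (le_trans (Fle x))// ler_peMl//; near: r; exact: nbhs_pinfty_ge.
have FP : (F : X -> R^o) \in clin by apply/asboolP.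
exists (Dual FP) => //=.
have [p Ap] := A0.
exact: (good_inj gA (AF z) (zA _ Ap)).
Unshelve. all: by end_near. Qed.

Lemma weak_continuous (f : dual X) : continuous (f : weak_space X -> R^o).
Proof.
move=> x; have /cvg_sup/(_ f) h : nbhs (x : weak_space X) --> (x : weak_space X).
  exact: cvg_id.
move=> A /(@initial_continuous _ _ f); exact: h.
Qed.

Lemma weak_hausdorff : hausdorff_space (weak_space X).
Proof.
move=> x y xy; apply/eqP; rewrite -subr_eq0 -normr_eq0; apply/eqP.
have [f _ fxy] := hahn_banach_norming (x - y : X).
rewrite -fxy linearB; apply/eqP; rewrite subr_eq0; apply/eqP.
apply: (@norm_hausdorff R R^o) => A B fA fB.
have [z [zA zB]] := xy _ _ (weak_continuous fA) (weak_continuous fB).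
by exists (f z).
Qed.

Lemma norm_cvg_weak (x : X) : nbhs x --> (x : weak_space X).
Proof.
apply/cvg_sup => f A [B [[C oC <-] /= Cfx]] sBA.
apply: filterS sBA _; apply: dual_continuous.
exact: open_nbhs_nbhs.
Qed.

Lemma weakly_compact_fatten (L : set X) (x : X) : weakly_compact L ->
  (forall t : {posnum R}, fatten L t%:num x) -> L x.
Proof.
move=> cL Lx; apply: (compact_closed weak_hausdorff cL) => B /norm_cvg_weak.
move=> /nbhs_normP[e /= e0 eB].
have e20 : 0 < e / 2 by rewrite divr_gt0.
have [a La [b + abx]] := Lx (PosNum e20); rewrite closed_unit_ballE /= => b1.
exists a; split=> //; apply: eB => /=; rewrite -abx addrC addKr.
have : e / 2 * `|b| <= e / 2 by rewrite ler_piMr// ltW.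
rewrite normrZ gtr0_norm//= => /le_lt_trans; apply; lra.
Qed.

End separation.

Record asymptotic (R : realType) := Asymptotic {
  asym_carrier :> Type;
  asym_le : {posnum R} -> asym_carrier -> asym_carrier -> Prop;
  asym_refl : forall t p, asym_le t p p;
  asym_mono : forall t s : {posnum R}, t%:num < s%:num ->
    forall p q, asym_le t p q -> asym_le s p q;
  asym_trans : forall p q r, (forall t, asym_le t p q) ->
    (forall t, asym_le t q r) -> forall t, asym_le t p r;
  asym_anti : forall p q, (forall t, asym_le t p q) ->
    (forall t, asym_le t q p) -> p = q }.

Section tukey.
Context {R : realType}.

Definition asym_of_poset (d : Order.disp_t) (P : porderType d) :
  asymptotic R.
Proof.
refine (@Asymptotic R P (fun _ p q => (p <= q)%O) _ _ _ _).
- by move=> _ p.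
- by [].
- by move=> p q r pq qr t; exact: le_trans (pq t) (qr t).
- by move=> p q pq qp; apply: le_anti; rewrite (pq 1%:pos) (qp 1%:pos).
Defined.

Definition tukey_le (P Q : asymptotic R) : Prop :=
  exists f : {posnum R} -> P -> Q,
    forall e : {posnum R}, exists d : {posnum R},
      forall q0 : Q, exists p0 : P,
        forall p : P, asym_le d (f e p) q0 -> asym_le e p p0.

Definition tukey_equiv (P Q : asymptotic R) : Prop :=
  tukey_le P Q /\ tukey_le Q P.

End tukey.

Section AK.
Context {R : realType} (X : normedModType R).

(* The empty set counts as weakly compact *)
Definition wcompact_ball : Type :=
  {K : set X | weakly_compact K /\ K `<=` closed_ball (0 : X) 1}.

Definition AK_le (t : {posnum R}) (K L : wcompact_ball) : Prop :=
  sval K `<=` fatten (sval L) t%:num.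

Lemma AK_le_forall (K L : wcompact_ball) :
  (forall t, AK_le t K L) <-> sval K `<=` sval L.
Proof.
split=> [KL x Kx|KL t x Kx].
  apply: weakly_compact_fatten; first by case: (svalP L).
  by move=> t; exact: KL.
exists x; first exact: KL.
by exists 0; [apply/closed_unit_ballP; rewrite normr0|rewrite scaler0 addr0].
Qed.

Definition AK : asymptotic R.
Proof.
refine (@Asymptotic R wcompact_ball AK_le _ _ _ _).
- by move=> t K; exact: (AK_le_forall K K).2.
- move=> t s ts K L KL x /KL[a La [b /closed_unit_ballP b1 <-]].
  exists a => //; exists ((t%:num / s%:num) *: b); last first.
    by rewrite scalerA mulrCA mulfV// mulr1.
  apply/closed_unit_ballP; rewrite normrZ ger0_norm// mulr_ile1//.
  by rewrite ler_pdivrMr// mul1r ltW.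
- move=> K L M /AK_le_forall KL /AK_le_forall LM; apply/AK_le_forall.
  exact: subset_trans LM.
- move=> [K PK] [L PL] /AK_le_forall/= KL /AK_le_forall/= LK.
  by apply: eq_exist; apply/seteqP.
Defined.

End AK.

(* Main.v *)
From HB Require Import structures.
Require Import Defs.
From mathcomp Require Import all_boot all_order all_algebra.
From mathcomp Require Import all_classical all_reals all_analysis.
From mathcomp Require Import ring lra.
Set Implicit Arguments.
Unset Strict Implicit.
Unset Printing Implicit Defensive.
Import Order.TTheory GRing.Theory Num.Theory.
Import numFieldNormedType.Exports.
Local Open Scope classical_set_scope.
Local Open Scope ring_scope.

(** Write B for the closed unit ball.

    A reduction of AK(B) to a point says that for each e > 0 some weakly compact
    K in B satisfies B <= K + e B (apply the reduction to singletons).  If X is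
    reflexive, K = B works, because then bounded ultrafilters converge weakly
    ([reflexive_weakly_compact_ball]).  Conversely this approximation property
    forces reflexivity ([reflexive_of_near_compact]): an element phi of the
    unit ball of the bidual is approximated by points of B on every finite set of
    functionals ([helly]), hence, up to e, by points of K, and a weak cluster
    point of the latter lies at distance at most e from phi in the bidual
    ([bidual_near_compact]); as X is complete, it is closed in the bidual, so
    phi belongs to X.

    A reduction of AK(B) to nat says that for each e > 0 there is a sequence of
    weakly compact sets K_n in B such that every weakly compact L in B is inside
    some K_n + e B.  When X is SWCG such sequences come from the dilates n K of
    the generating set, pulled back into B and made increasing
    ([SWCG_cofinal]).  Conversely, the countably many sets obtained for
    e = 1, 1/2, 1/3, ... can be shrunk to a sequence tending to 0 in norm, whose
    union with 0 is again weakly compact ([weakly_compact_shrinking]) and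
    witnesses SWCG, because weakly compact sets are bounded and can be scaled
    into B ([weakly_compact_bounded]).

    Finally, when B is weakly compact it is a largest element of AK(B), so no
    reduction of nat to AK(B) exists; and when X is SWCG but not reflexive, for
    some e there are points x_n of B outside K_n + e B, where (K_n) is an
    increasing sequence as above for e / 2; then no weakly compact L in B
    contains infinitely many x_n up to e / 2 ([nat_tukey_le_AK]). *)

(** * Weak convergence and weak compactness *)

Lemma weak_cvgP (R : realType) (X : normedModType R) (F : set_system X)
    (x : X) : Filter F ->
  (F --> (x : weak_space X)) <->
  forall f : dual X, (f : X -> R^o) @ F --> (f x : R^o).
Proof.
move=> FF; split=> [Fx f|Ff].
  exact: cvg_trans (cvg_app f Fx) (@weak_continuous R X f x).
apply/cvg_sup => f A [B [[C oC <-] /= Cfx]] sBA.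
by apply: filterS sBA _; apply: Ff; exact: open_nbhs_nbhs.
Qed.

(** The norm is weakly lower semicontinuous, being a supremum of functionals:
    test the limit against a functional that norms it. *)
Lemma weak_lim_norm_le (R : realType) (X : normedModType R) (F : set_system X)
    (x : X) (r : R) : ProperFilter F ->
  (F --> (x : weak_space X)) -> F [set y | `|y| <= r] -> `|x| <= r.
Proof.
move=> FF /weak_cvgP Fx Fr; have [f fle <-] := hahn_banach_norming x.
have /= := @closed_cvg _ _ _ _ f _ (@closed_le R r) _ _ (Fx f); apply.
by apply: filterS Fr => y /=; apply: le_trans; exact: le_trans (ler_norm _) _.
Qed.

Lemma weakly_compactP (R : realType) (X : normedModType R) (K : set X) :
  weakly_compact K <->
  forall F : set_system X, UltraFilter F -> F K ->
    exists2 x, K x & forall f : dual X, (f : X -> R^o) @ F --> (f x : R^o).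
Proof.
rewrite /weakly_compact compact_ultra /=; split=> h F FU FK.
  have [x [Kx Fx]] := h F FU FK; exists x => //.
  by apply/weak_cvgP.
have [x Kx Fx] := h F FU FK; exists x; split => //.
by apply/weak_cvgP.
Qed.

Lemma ultra_fmap (T U : Type) (f : T -> U) (F : set_system T) :
  UltraFilter F -> UltraFilter (f @ F).
Proof.
move=> FU; have FP := @ultra_proper _ _ FU.
split; first exact: fmap_proper_filter.
move=> G GP sFG; apply/seteqP; split=> // A GA.
have [//|FnA] := in_ultra_setVsetC (f @^-1` A) FU.
exfalso; apply: (@filter_not_empty _ G); rewrite -(setICr A).
by apply: filterI => //; exact: sFG.
Qed.

Lemma weakly_compactZ (R : realType) (X : normedModType R) (K : set X) (a : R) :
  weakly_compact K -> weakly_compact [set a *: x | x in K].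
Proof.
move=> /(@continuous_compact (weak_space X) (weak_space X) ( *:%R a)); apply.
apply: continuous_subspaceT => x.
have xP : Filter (nbhs (x : weak_space X)) by exact: nbhs_filter.
apply: (weak_cvgP _ (fmap_filter _ xP)).2 => f; rewrite linearZ.
rewrite -fmap_comp.
have -> : f \o *:%R a = a \*: (f : X -> R^o).
  by apply/funext => y /=; rewrite linearZ.
exact: (@cvgZl_tmp _ R^o _ _ xP a _ _ (@weak_continuous _ _ f x)).
Qed.

Lemma weakly_compactI_ball (R : realType) (X : normedModType R) (K : set X)
    (r : R) : weakly_compact K -> weakly_compact (K `&` [set x | `|x| <= r]).
Proof.
move=> /weakly_compactP cK; apply/weakly_compactP => F FU FKr.
have FP := @ultra_proper _ _ FU.
have [x Kx Fx] := cK F FU (filterS (@subIsetl _ _ _) FKr).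
exists x => //; split=> //=; apply: (@weak_lim_norm_le _ _ F).
  exact/weak_cvgP.
by apply: filterS FKr => y [].
Qed.

Lemma weakly_compact1 (R : realType) (X : normedModType R) (x : X) :
  weakly_compact [set x].
Proof. exact: (@compact_set1 (weak_space X)). Qed.

Lemma weakly_compactU (R : realType) (X : normedModType R) (K L : set X) :
  weakly_compact K -> weakly_compact L -> weakly_compact (K `|` L).
Proof. exact: (@compactU (weak_space X)). Qed.

Lemma weakly_compact_bigcup_ord (R : realType) (X : normedModType R)
    (K : nat -> set X) (N : nat) : (forall n, weakly_compact (K n)) ->
  weakly_compact (\bigcup_(n in `I_N) K n).
Proof.
move=> cK; elim: N => [|N IH]; last first.
  by rewrite IIS bigcup_setU bigcup_set1; exact: weakly_compactU.
by rewrite II0 bigcup_set0; exact: (@compact0 (weak_space X)).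
Qed.

(** An ultrafilter on the union either contains one of the sets, and converges
    there, or contains every tail of the union; the tails have small norm, so
    in the second case it tends to 0 in norm. *)
Lemma weakly_compact_shrinking (R : realType) (X : normedModType R)
    (K : nat -> set X) : (forall n, weakly_compact (K n)) ->
  (forall n x, K n x -> `|x| <= n.+1%:R^-1) ->
  weakly_compact (0 |` \bigcup_n K n).
Proof.
move=> cK Ksmall; apply/weakly_compactP => F FU FK.
have FP := @ultra_proper _ _ FU.
have [[n Fn]|nF] := pselect (exists n, F (K n)).
  have [x Kx Fx] := (weakly_compactP _).1 (cK n) F FU Fn.
  by exists x => //; right; exists n.
exists 0; first by left.
apply/weak_cvgP; apply: cvg_trans (@norm_cvg_weak R X 0).
apply/cvgr0Pnorm_le => e e0.
have [N _ /(_ N (leqnn N))/= Ne] := near_infty_natSinv_lt (PosNum e0).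
have : F (\bigcap_(n in `I_N) ~` K n).
  elim: N {Ne} => [|N IH].
    by rewrite II0 bigcap_set0; exact: filterT.
  rewrite IIS bigcap_setU bigcap_set1; apply: filterI => //.
  by have [FN|//] := in_ultra_setVsetC (K N) FU; case: nF; exists N.
move/(filterI FK); apply: filterS => x [[->|[n _ Kx]] nK].
  by rewrite normr0 ltW.
apply: le_trans (Ksmall _ _ Kx) _; apply: le_trans (ltW Ne).
rewrite lef_pV2 ?posrE// ler_nat ltnS leqNgt.
by apply/negP => nN; exact: (nK n nN).
Qed.

(** * Functionals as pointwise limits; completeness of the dual *)

Lemma dual_of_bounded_linear (R : realType) (X : normedModType R)
    (F : X -> R^o) (M : R) : linear F -> (forall x, `|F x| <= M * `|x|) ->
  exists f : dual X, forall x, f x = F x.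
Proof.
move=> linF FM.
pose L := GRing.isLinear.Build R X R^o *:%R F linF.
pose F' : {linear X -> R^o} := HB.pack (F : X -> R^o) L.
have cF : continuous (F : X -> R^o).
  apply: (@bounded_linear_continuous R X R^o F').
  apply/linear_boundedP; near=> r => x.
  by rewrite (le_trans (FM x))// ler_wpM2r.
have FP : (F : X -> R^o) \in clin by apply/asboolP.
by exists (Dual FP).
Unshelve. all: by end_near. Qed.

(** Linearity and a norm bound pass to pointwise limits.  The index type [T] is
    arbitrary because two kinds of filters occur: filters of functionals, for
    the completeness of the dual, and filters of points of X seen as functionals
    on the dual, which produce elements of the bidual. *)
Lemma dual_pointwise_lim (R : realType) (X : normedModType R) (T : Type)
    (F : set_system T) (u : T -> X -> R^o) (g : X -> R^o) (M : R) :
  ProperFilter F -> (forall t, linear (u t)) ->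
  (\forall t \near F, forall x, `|u t x| <= M * `|x|) ->
  (forall x, u t x @[t --> F] --> g x) ->
  exists f : dual X, forall x, f x = g x.
Proof.
move=> FF lu uM ug; apply: (@dual_of_bounded_linear _ _ _ M).
- move=> a x y; apply: (@cvg_unique _ (@norm_hausdorff R R^o) _ _ _ _ (ug _)).
  have -> : u ^~ (a *: x + y) = (a \*: u ^~ x) \+ u ^~ y.
    by apply/funext => t /=; rewrite lu.
  apply: (@cvgD _ R^o) (ug y); exact: (@cvgZl_tmp _ R^o).
- move=> x; apply: (closed_cvg (fun r : R => r <= M * `|x|) (@closed_le _ _)
    _ _ (cvg_norm (ug x))).
  by apply: filterS uM => t /=.
Qed.

Lemma dual_cauchy_cvg (R : realType) (X : normedModType R)
    (F : set_system (dual X)) : ProperFilter F -> cauchy F -> cvg F.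
Proof.
move=> FF cF.
have near_ball e : 0 < e -> exists g : dual X,
    F [set f : dual X | forall x, `|g x - f x| <= e * `|x|].
  move=> e0; have [g Fg] := (@cauchyP R (dual X) F FF).1 cF e e0.
  exists g; apply: filterS Fg => f; rewrite -ball_normE /= => /ltW gf x.
  by apply: le_trans (dual_le_norm (g - f) x) _; rewrite ler_wpM2r.
have cvgx x : exists l : R^o, (f : dual X) x @[f --> F] --> l.
  apply/cvg_ex/cauchy_cvgP/cauchy_exP => e e0.
  have x1 : 0 < `|x| + 1 by rewrite ltr_wpDl.
  have d0 : 0 < e / 2 / (`|x| + 1) by rewrite !divr_gt0.
  have [g Fg] := near_ball _ d0.
  exists (g x); apply: (filterS _ Fg : F [set f : dual X | ball (g x) e (f x)]).
  move=> f /(_ x) gf; rewrite /= -ball_normE /=; apply: (le_lt_trans gf).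
  rewrite mulrAC ltr_pdivrMr// -mulrA ltr_pM2l//.
  by rewrite ltr_pwDr// ler_piMl// invf_le1// ler1n.
have [l Fl] := choice cvgx.
have [h hl] : exists h : dual X, forall x, h x = l x.
  have [g Fg] := near_ball 1 ltr01.
  apply: (@dual_pointwise_lim _ _ _ F (fun f : dual X => f) _ (`|g| + 1)) => //.
    exact: dual_linear.
  apply: filterS Fg => f gf x; rewrite mulrDl.
  apply: le_trans (lerD (dual_le_norm g x) (gf x)).
  by have := ler_normB (g x) (g x - f x); rewrite subKr.
apply/cvg_ex; exists h; apply/cvgrPdist_le => e e0.
have [g Fg] := near_ball (e / 2) (divr_gt0 e0 (ltr0n _ 2)).
apply: filterS (Fg) => f gf; apply: dual_norm_le => x x1.
have gh : `|g x - h x| <= e / 2 * `|x|.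
  rewrite hl.
  apply: (closed_cvg (fun r : R => r <= e / 2 * `|x|) (@closed_le _ _) _ _
    (cvg_norm (cvgB (cvg_cst (g x)) (Fl x)))).
  by apply: filterS Fg => k /(_ x).
have -> : (h - f) x = (g x - f x) - (g x - h x).
  have -> : (h - f) x = h x - f x by [].
  ring.
apply: le_trans (ler_normB _ _) _.
have := gf x; nra.
Qed.

HB.instance Definition _ (R : realType) (X : normedModType R) :=
  Uniform_isComplete.Build (dual X) (@dual_cauchy_cvg R X).

(** The points of [K], as functionals on the complete space [dual X], are
    pointwise bounded because a functional is bounded on a weakly compact set;
    uniform boundedness then bounds [K], by the norming functionals. *)
Lemma weakly_compact_bounded (R : realType) (X : normedModType R) (K : set X) :
  weakly_compact K -> exists M : R, forall x, K x -> `|x| <= M.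
Proof.
move=> cK.
pose FK := [set (fun f : dual X => f x : R^o) | x in K].
have /(_ 1)[M FM] : uniform_bounded FK.
  apply: Banach_Steinhauss => [_ [x Kx <-]|f].
    split=> // r; exists (r * `|x|) => f fr.
    by apply: le_trans (dual_le_norm f x) _; rewrite ler_wpM2r.
  have /compact_bounded/pinfty_ex_gt0[M _ fM] :
      compact ((f : X -> R^o) @` K).
    apply: (@continuous_compact (weak_space X) R^o f) => //.
    exact/continuous_subspaceT/weak_continuous.
  by exists M => _ [x Kx <-]; apply: fM; exists x.
exists M => x Kx; have [f fle fx] := hahn_banach_norming x.
rewrite -fx; apply: le_trans (ler_norm _) _.
apply: (FM (fun f : dual X => f x)); first by exists x.
by apply: dual_norm_le => y y1; exact: le_trans (fle y) y1.
Qed.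

(** * Reflexivity and weak compactness of the unit ball *)

(** Along an ultrafilter on the ball each functional has a limit; these limits
    form an element of the bidual, and the point representing it is the weak
    limit. *)
Lemma reflexive_weakly_compact_ball (R : realType) (X : normedModType R) :
  reflexive_space X -> weakly_compact (closed_ball (0 : X) 1).
Proof.
move=> refl; apply/weakly_compactP => F FU; rewrite closed_unit_ballE => FB.
have FP := @ultra_proper _ _ FU.
have cvgf (f : dual X) : exists l : R^o, f x @[x --> F] --> l.
  have := @segment_compact R (- `|f|) `|f|.
  rewrite compact_ultra => /(_ (f @ F)).
  case; first exact: ultra_fmap.
    apply: (filterS _ FB : F [set x | `[- `|f|, `|f|]%classic (f x)]).
    by move=> x /= x1; rewrite in_itv/= -ler_norml; exact: dual_norm_ub.
  by move=> l [_ fl]; exists l.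
have [l Fl] := choice cvgf.
have [phi phiE] : exists phi : dual (dual X), forall f, phi f = l f.
  apply: (@dual_pointwise_lim _ _ _ F (fun x (f : dual X) => f x) _ 1) => //.
  apply: filterS FB => x /= x1 f; rewrite mul1r; exact: dual_norm_ub.
have [x xphi] := refl phi.
have Fx (f : dual X) : (f : X -> R^o) @ F --> (f x : R^o).
  by rewrite -xphi phiE.
exists x => //=; apply: (@weak_lim_norm_le _ _ F) => //.
exact/weak_cvgP.
Qed.

Lemma dual_sumE (R : realType) (X : normedModType R) (I : Type) (s : seq I)
    (c : I -> R) (f : I -> dual X) (x : X) :
  (\sum_(i <- s) c i *: f i) x = \sum_(i <- s) c i * f i x :> R.
Proof. exact: (big_morph (fun g : dual X => g x : R)). Qed.

Lemma ler_norml_sqr (R : realDomainType) (a b : R) : 0 <= b ->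
  (`|a| <= b) = (a ^+ 2 <= b ^+ 2).
Proof. by move=> b0; rewrite -(real_normK (num_real a)) ler_sqr ?nnegrE. Qed.

(** Helly's condition.  Let [q x] be the sum of the squares of the errors
    [f x - phi f].  If its infimum [m] over the ball were positive, then at a
    nearly minimal [x] the first-order condition along the segments from [x]
    to points of the ball says that [x] nearly minimises on the ball the
    functional [g], the sum of the [(f x - phi f) *: f]; thus [`|g|] is at most
    [- g x] up to [m / 2].  But [phi g = g x - q x] is at most [g x - m], hence
    less than [- `|g|]. *)
Lemma helly (R : realType) (X : normedModType R) (phi : dual (dual X))
    (fs : seq (dual X)) (eta : R) :
  (forall g, `|phi g| <= `|g|) -> 0 < eta ->
  exists2 x, `|x| <= 1 & forall f, f \in fs -> `|f x - phi f| <= eta.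
Proof.
move=> phi1 eta0.
pose c x (f : dual X) : R := f x - phi f.
pose q x := \sum_(f <- fs) c x f ^+ 2.
have q0 x : 0 <= q x by apply: sumr_ge0 => f _; exact: sqr_ge0.
suff [x x1 qx] : exists2 x, `|x| <= 1 & q x <= eta ^+ 2.
  exists x => // f ffs.
  have := ler_norml_sqr (c x f) (ltW eta0); rewrite /c => ->.
  rewrite -/(c x f); apply: le_trans qx; rewrite /q (big_rem f)//= lerDl.
  by apply: sumr_ge0 => g _; exact: sqr_ge0.
pose Q := [set q x | x in [set x | `|x| <= 1]].
have infQ : has_inf Q.
  split; first by exists (q 0), 0; rewrite //= normr0.
  by exists 0 => _ [x _ <-].
set m := inf Q.
have mle x : `|x| <= 1 -> m <= q x.
  by move=> x1; apply: ge_inf; [case: infQ|exists x].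
have [m_gt0|m_le0] := ltP 0 m; last first.
  have [_ [x x1 <-] qx] := inf_adherent (exprn_gt0 2 eta0) infQ.
  by exists x => //; rewrite ltW// (lt_le_trans qx)// -lerBrDr subrr.
exfalso.
pose M := \sum_(f <- fs) (2 * `|f|) ^+ 2.
have M0 : 0 <= M by apply: sumr_ge0 => f _; exact: sqr_ge0.
(* [t] is the length of a step along a segment of the ball; the second-order
   term of [q] along a segment is at most [M * t ^+ 2], and [x] below is
   minimal up to [t ^+ 2], so both errors are at most [m * t] together. *)
have [t [t0 t1 tm]] : exists t, [/\ 0 < t, t <= 1 & t * (1 + M) <= m].
  have M1 : 0 < 1 + M by lra.
  exists (Num.min 1 (m / (1 + M))); split.
  - by rewrite lt_min ltr01 divr_gt0.
  - by rewrite ge_min lexx.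
  - by rewrite -ler_pdivlMr// ge_min lexx orbT.
have [_ [x x1 <-]] := inf_adherent (exprn_gt0 2 t0) infQ; rewrite -/m => qx.
pose g := \sum_(f <- fs) c x f *: f.
have gE y : g y = \sum_(f <- fs) c x f * f y :> R by exact: dual_sumE.
have lo y : `|y| <= 1 -> g x - m / 2 <= g y.
  move=> y1; pose z := x + t *: (y - x).
  have z1 : `|z| <= 1.
    have -> : z = (1 - t) *: x + t *: y.
      by rewrite /z scalerBr scalerBl scale1r addrA addrAC.
    rewrite (le_trans (ler_normD _ _))// !normrZ (ger0_norm (ltW t0)).
    rewrite ger0_norm ?subr_ge0// -[leRHS](subrK t) lerD//.
      by rewrite ler_piMr// subr_ge0.
    by rewrite ler_piMr// ltW.
  have qz : q z <= q x + 2 * t * (g y - g x) + t ^+ 2 * M.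
    rewrite !gE -sumrB !mulr_sumr -!big_split/=; apply: ler_sum => f _.
    have -> : c z f = c x f + t * (f y - f x).
      rewrite /c /z linearD linearZ linearB /=.
      by rewrite /GRing.scale/=; ring.
    have fyx : (f y - f x) ^+ 2 <= (2 * `|f|) ^+ 2.
      rewrite -ler_norml_sqr ?mulr_ge0//; apply: le_trans (ler_normB _ _) _.
      have := dual_norm_ub f x1; have := dual_norm_ub f y1.
      by rewrite /Num.norm/=; lra.
    have := sqr_ge0 t; nra.
  have := mle _ z1; nra.
have gm : `|g| <= m / 2 - g x.
  apply: dual_norm_le => y y1; rewrite ler_norml; apply/andP; split.
    by have := lo y y1; lra.
  have := lo (- y); rewrite normrN linearN => /(_ y1); lra.
have : phi g = g x - q x :> R.
  rewrite gE /q linear_sum -sumrB; apply: eq_bigr => f _.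
  by rewrite linearZ /= /GRing.scale/= /c; ring.
have := phi1 g; rewrite ler_norml => /andP[+ _] phig; rewrite phig.
have := mle x x1; lra.
Qed.

(** Write the points of the ball given by [helly] as [k + e *: b] with [k] in
    [K].  The points [k] are within [e * `|f|] of [phi] on any finite set of
    functionals [f], up to an arbitrarily small error, so a weak cluster point
    of them, which exists by compactness, is within [e * `|f|] on all [f]. *)
Lemma bidual_near_compact (R : realType) (X : normedModType R) (K : set X)
    (e : R) (phi : dual (dual X)) :
  weakly_compact K -> 0 <= e -> closed_ball (0 : X) 1 `<=` fatten K e ->
  (forall g, `|phi g| <= `|g|) ->
  exists x, forall f : dual X, `|f x - phi f| <= e * `|f|.
Proof.
move=> cK e0 BK phi1.
pose D := [set p : seq (dual X) * R | 0 < p.2].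
pose B (p : seq (dual X) * R) :=
  [set k | K k /\ forall f, f \in p.1 -> `|f k - phi f| <= e * `|f| + p.2].
have FF : ProperFilter (filter_from D B).
  apply: filter_from_proper; last first.
    move=> [fs eta] /= eta0; have [x x1 xphi] := helly fs phi1 eta0.
    have /BK[k Kk [b + kbx]] := (closed_unit_ballP x).2 x1.
    rewrite closed_unit_ballE /= => b1.
    exists k; split=> // f ffs.
    have -> : f k - phi f = (f x - phi f) - e * f b.
      rewrite -kbx linearD linearZ /= /GRing.scale/=; ring.
    apply: le_trans (ler_normB _ _) _; rewrite addrC lerD ?xphi//.
    by rewrite normrM ger0_norm// ler_wpM2l// dual_norm_ub.
  apply: filter_from_filter; first by exists ([::], 1); rewrite /D/=.
  move=> [fs1 r1] [fs2 r2] /= r10 r20.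
  exists (fs1 ++ fs2, Num.min r1 r2); first by rewrite /D/= lt_min r10.
  move=> k [Kk kf]; split; split=> // f ffs; apply: le_trans (kf f _) _;
    by rewrite ?mem_cat ?ffs ?orbT// lerD2l ge_min lexx ?orbT.
have FK : filter_from D B K by exists ([::], 1); [rewrite /D/=|move=> k []].
have [x [Kx clx]] := cK _ FF FK.
exists x => f; apply/ler_addgt0Pr => eta eta0.
have eta20 : 0 < eta / 2 by rewrite divr_gt0.
have Fx : filter_from D B (B ([:: f], eta / 2)) by exists ([:: f], eta / 2).
have nx : nbhs (x : weak_space X) [set y | `|f x - f y| <= eta / 2].
  exact: ((cvgrPdist_le (f : X -> R^o) _).1 (@weak_continuous _ _ f x) _ eta20).
have [y [[Ky yf] /= xy]] := clx _ _ Fx nx.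
have := yf f; rewrite mem_head /= => /(_ isT) {}yf.
have -> : f x - phi f = (f x - f y) + (f y - phi f) by ring.
apply: le_trans (ler_normD _ _) _; lra.
Qed.

(** By [bidual_near_compact], after scaling, [phi] is a norm limit in the bidual
    of points of [X]; they form a Cauchy sequence, since the norm of [X] is
    computed by functionals, and its limit represents [phi]. *)
Lemma reflexive_of_near_compact (R : realType) (X : completeNormedModType R) :
  (forall e : {posnum R}, exists2 K : set X, weakly_compact K &
     closed_ball (0 : X) 1 `<=` fatten K e%:num) ->
  reflexive_space X.
Proof.
move=> BK phi0.
(* Normalise [phi0]; the [+ 1] covers the case [phi0 = 0]. *)
pose a := `|phi0| + 1.
have a0 : 0 < a by rewrite ltr_wpDl.
pose phi := a^-1 *: phi0.
have phi1 g : `|phi g| <= `|g|.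
  have -> : phi g = a^-1 * phi0 g :> R by [].
  rewrite normrM gtr0_norm ?invr_gt0// ler_pdivrMl//.
  by apply: le_trans (dual_le_norm phi0 g) _; rewrite ler_wpM2r// lerDl.
suff [x xphi] : exists x, forall f, phi f = f x.
  exists (a *: x) => f; rewrite linearZ /= -xphi.
  have -> : phi f = a^-1 * phi0 f :> R by [].
  by rewrite /GRing.scale/= mulVKf// gt_eqF.
have approx (n : nat) : exists x, forall f : dual X,
    `|f x - phi f| <= n.+1%:R^-1 * `|f|.
  have [K cK KB] := BK (PosNum (ltac:(by []) : 0 < n.+1%:R^-1 :> R)).
  exact: bidual_near_compact KB phi1.
have [u uphi] := choice approx.
have cu : cauchy (u @ \oo).
  apply: cauchy_exP => e e0.
  have e20 : 0 < e / 2 by rewrite divr_gt0.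
  have [N _ Ne] := near_infty_natSinv_lt (PosNum e20).
  exists (u N); exists N => // n /= Nn; rewrite -ball_normE /=.
  have [f f1 <-] := hahn_banach_norming (u N - u n).
  have {}f1 : `|f| <= 1.
    by apply: dual_norm_le => x x1; exact: le_trans (f1 x) x1.
  have /= hN := Ne _ (leqnn N); have /= hn := Ne _ Nn.
  have le_inv k : `|f (u k) - phi f| <= k.+1%:R^-1.
    by apply: le_trans (uphi k f) _; rewrite ler_piMr.
  have -> : f (u N - u n) = (f (u N) - phi f) - (f (u n) - phi f).
    by rewrite linearB /=; ring.
  apply: le_lt_trans (ler_norm _) _; apply: le_lt_trans (ler_normB _ _) _.
  by apply: le_lt_trans (lerD (le_inv N) (le_inv n)) _; rewrite [e]splitr ltrD.
have cvgu : cvg (u @ \oo) by exact/cauchy_cvgP.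
have ux : u @ \oo --> lim (u @ \oo) := cvgu.
set x := lim _ in ux.
exists x => f; symmetry.
have fux : (f \o u) @ \oo --> (f x : R^o).
  exact: cvg_trans (cvg_app f ux) (@dual_continuous _ _ f x).
apply: (@cvg_unique _ (@norm_hausdorff R R^o) _ _ _ _ fux).
apply/cvgrPdist_le => e e0.
have f10 : 0 < `|f| + 1 by rewrite ltr_wpDl.
have ef0 : 0 < e / (`|f| + 1) by rewrite divr_gt0.
have [N _ Ne] := near_infty_natSinv_lt (PosNum ef0).
exists N => // n /= /Ne/= /ltW nef; rewrite distrC.
apply: le_trans (uphi n f) _.
apply: le_trans (ler_wpM2r (normr_ge0 f) nef) _.
by rewrite mulrAC ler_pdivrMr// ler_wpM2l ?ltW// ltrDl.
Qed.

(** * Neighbourhoods of sets *)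

Lemma fattenP (R : realType) (X : normedModType R) (A : set X) (t : R) (x : X) :
  0 < t -> fatten A t x <-> exists2 a, A a & `|x - a| <= t.
Proof.
move=> t0; split=> [[a Aa [b + <-]]|[a Aa xa]].
  rewrite closed_unit_ballE /= => b1; exists a => //.
  by rewrite addrC addKr normrZ gtr0_norm// ler_piMr// ltW.
exists a => //; exists (t^-1 *: (x - a)).
  rewrite closed_unit_ballE /= normrZ gtr0_norm ?invr_gt0//.
  by rewrite ler_pdivrMl// mulr1.
by rewrite scalerA mulfV ?gt_eqF// scale1r addrC subrK.
Qed.

Lemma subset_fatten (R : realType) (X : normedModType R) (A B : set X) (t : R) :
  A `<=` B -> fatten A t `<=` fatten B t.
Proof. by move=> AB _ [a /AB Ba [b b1 <-]]; exists a => //; exists b. Qed.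

Lemma fatten_trans (R : realType) (X : normedModType R) (A B C : set X)
    (s t : R) : 0 < s -> 0 < t ->
  A `<=` fatten B s -> B `<=` fatten C t -> A `<=` fatten C (s + t).
Proof.
move=> s0 t0 AB BC x /AB /(fattenP _ _ s0)[b /BC /(fattenP _ _ t0)[c Cc bc] xb].
apply/fattenP; first exact: addr_gt0.
exists c => //; rewrite -(subrKA b) (le_trans (ler_normD _ _))//.
exact: lerD.
Qed.

Definition wcompact_ball_of (R : realType) (X : normedModType R) (K : set X)
    (cK : weakly_compact K) (KB : K `<=` closed_ball (0 : X) 1) :
  wcompact_ball X := exist _ K (conj cK KB).

Lemma set1_sub_ball (R : realType) (X : normedModType R) (x : X) :
  `|x| <= 1 -> [set x] `<=` closed_ball (0 : X) 1.
Proof. by move=> x1 _ ->; apply/closed_unit_ballP. Qed.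

Definition ball_point (R : realType) (X : normedModType R) (x : X)
    (x1 : `|x| <= 1) : wcompact_ball X :=
  wcompact_ball_of (@weakly_compact1 R X x) (set1_sub_ball x1).

(** * Tukey reductions *)

Lemma AK_tukey_le_point (R : realType) (X : normedModType R) :
  reflexive_space X -> tukey_le (AK X) (asym_of_poset 'I_1).
Proof.
move=> /reflexive_weakly_compact_ball cB.
exists (fun _ _ => ord0) => e; exists e => q0.
exists (wcompact_ball_of cB (@subset_refl _ _)) => L _.
by apply: ((AK_le_forall _ _).2 _ e) => /=; case: (svalP L).
Qed.

Lemma point_tukey_le_AK (R : realType) (X : normedModType R) :
  tukey_le (asym_of_poset 'I_1) (AK X).
Proof.
have x1 : `|0 : X| <= 1 by rewrite normr0.
exists (fun _ _ => ball_point x1 : AK X) => e; exists e => q0.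
by exists ord0 => p _ /=; rewrite (ord1 p).
Qed.

Lemma reflexive_of_tukey (R : realType) (X : completeNormedModType R) :
  tukey_le (AK X) (asym_of_poset 'I_1) -> reflexive_space X.
Proof.
move=> [f fP]; apply: reflexive_of_near_compact => e.
have [d /(_ ord0)[[K [cK KB]] LK]] := fP e.
exists K => // x /closed_unit_ballP x1.
by apply: (LK (ball_point x1)) => //=; rewrite (ord1 (f _ _)).
Qed.

(** If [X] were reflexive, the ball would be a largest element of [AK X], and
    the reduction would bound all of [nat]. *)
Lemma nonreflexive_of_tukey (R : realType) (X : normedModType R) :
  tukey_le (asym_of_poset nat) (AK X) -> ~ reflexive_space X.
Proof.
move=> [f fP] /reflexive_weakly_compact_ball cB.
have [d dP] := fP 1%:pos.
have [p0 p0P] := dP (wcompact_ball_of cB (@subset_refl _ _)).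
suff : (p0.+1 <= p0)%N by rewrite ltnn.
apply: p0P; apply: ((AK_le_forall _ _).2 _ d) => /=.
by case: (svalP (f 1%:pos p0.+1)).
Qed.

(** Up to [e / 2], a set [L] inside the ball is covered by the part of [n K0] of
    norm at most [1 + e / 2]; dividing this part by [1 + e / 2] brings it into
    the ball and moves its points by at most [e / 2].  Finite unions make the
    sequence increasing. *)
Lemma SWCG_cofinal (R : realType) (X : normedModType R) (e : {posnum R}) :
  SWCG X -> exists K : nat -> wcompact_ball X,
    (forall L, exists n, AK_le e L (K n)) /\
    (forall m n, (m <= n)%N -> sval (K m) `<=` sval (K n)).
Proof.
move=> [K0 cK0 K0P].
pose h : R := e%:num / 2.
have h0 : 0 < h by rewrite divr_gt0.
have h10 : 0 < 1 + h by rewrite addr_gt0.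
pose G n := [set (1 + h)^-1 *: x |
  x in [set n%:R *: x | x in K0] `&` [set x | `|x| <= 1 + h]].
have cG n : weakly_compact (G n).
  exact/weakly_compactZ/weakly_compactI_ball/weakly_compactZ.
have GB n : G n `<=` closed_ball (0 : X) 1.
  move=> _ [x [_ /= xh] <-]; apply/closed_unit_ballP.
  by rewrite normrZ gtr0_norm ?invr_gt0// ler_pdivrMl// mulr1.
pose U n := \bigcup_(k in `I_n.+1) G k.
have cU n : weakly_compact (U n) by exact: weakly_compact_bigcup_ord.
have UB n : U n `<=` closed_ball (0 : X) 1 by move=> x [k _ /GB].
exists (fun n => wcompact_ball_of (cU n) (UB n)); split; last first.
  by move=> m n mn x /= [k /= km Gx]; exists k => //=; exact: leq_trans km _.
move=> [L [cL LB]]; have [n LK] := K0P _ h0 _ cL.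
exists n => x /= Lx; apply/fattenP => //.
have /(fattenP _ _ h0)[y Ky xy] := LK _ Lx.
have x1 : `|x| <= 1 by apply/closed_unit_ballP/LB.
have yh : `|y| <= 1 + h.
  by rewrite -[y](subKr x) (le_trans (ler_normB _ _))// lerD.
exists ((1 + h)^-1 *: y); first by exists n => //=; exists y.
have -> : x - (1 + h)^-1 *: y = (x - y) + (h / (1 + h)) *: y.
  rewrite -addrA; congr (_ + _).
  rewrite -scaleNr -[- y]scaleN1r -scalerDl; congr (_ *: _).
  by field; rewrite gt_eqF.
rewrite (le_trans (ler_normD _ _))// [e%:num]splitr lerD// normrZ.
rewrite (gtr0_norm (divr_gt0 h0 h10)).
by rewrite mulrAC ler_pdivrMr// ler_wpM2l// ltW.
Qed.

Lemma AK_tukey_le_nat (R : realType) (X : normedModType R) :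
  SWCG X -> tukey_le (AK X) (asym_of_poset nat).
Proof.
move=> sX.
have [K KP] := choice (fun e : {posnum R} => SWCG_cofinal e sX).
pose f e := choice (KP e).1.
exists (fun e => projT1 (f e)) => e; exists e => n; exists (K e n) => L /= fLn.
apply: subset_trans (projT2 (f e) L) _; apply: subset_fatten.
exact: (KP e).2.
Qed.

(** Non-reflexivity gives an [e] for which no weakly compact set is [e]-dense in
    the ball; [n] is sent to a point [x n] of the ball that is not within [e]
    of the [n]-th set of an increasing sequence, cofinal up to [e / 2].  If [x n]
    is within [e / 2] of [L], and [L] within [e / 2] of the [m]-th set, then
    [x n] is within [e] of the [m]-th set, which forces [n <= m]. *)
Lemma nat_tukey_le_AK (R : realType) (X : completeNormedModType R) :
  SWCG X -> ~ reflexive_space X -> tukey_le (asym_of_poset nat) (AK X).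
Proof.
move=> sX nrefl.
have [e eP] : exists e : {posnum R}, forall K : set X, weakly_compact K ->
    ~ closed_ball (0 : X) 1 `<=` fatten K e%:num.
  apply: contrapT => nex; apply/nrefl/reflexive_of_near_compact => e.
  apply: contrapT => nK; apply: nex; exists e => K cK BK.
  by apply: nK; exists K.
have d0 : 0 < e%:num / 2 by [].
pose d := PosNum d0.
have [K [Kcof Kmono]] := SWCG_cofinal d sX.
have /choice[x xP] : forall n : nat, exists x : X,
    `|x| <= 1 /\ ~ fatten (sval (K n)) e%:num x.
  move=> n; have [cK _] := svalP (K n).
  apply: contrapT => nx; apply: (eP _ cK) => x /closed_unit_ballP x1.
  by apply: contrapT => nKx; apply: nx; exists x.
exists (fun _ n => ball_point (xP n).1 : AK X) => t; exists d => L.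
have [m LK] := Kcof L; exists m => n xL /=.
rewrite leEnat leqNgt; apply/negP => mn; apply: (xP n).2.
apply: (subset_fatten (Kmono _ _ (ltnW mn))).
rewrite [e%:num]splitr; exact: (fatten_trans _ _ xL LK).
Qed.

(** For each [k] and [n], the sets that the reduction at scale [1 / k.+1] sends
    to at most [n] lie within [1 / k.+1] of a single weakly compact set [P (k, n)].
    Enumerating these as [D j] and shrinking [D j] by [j.+1] gives one weakly
    compact set, which has a dilate around each dilate [N * D j]. *)
Lemma SWCG_of_tukey (R : realType) (X : normedModType R) :
  tukey_le (AK X) (asym_of_poset nat) -> SWCG X.
Proof.
move=> [f fP].
have e0 k : 0 < k.+1%:R^-1 :> R by rewrite invr_gt0.
pose e k := PosNum (e0 k).
have /choice[P PP] : forall kn : nat * nat, exists p : wcompact_ball X,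
    forall L, (f (e kn.1) L <= kn.2)%N -> AK_le (e kn.1) L p.
  by move=> kn; have [d /(_ kn.2)[p pP]] := fP (e kn.1); exists p.
pose D j := sval (P (odflt (0%N, 0%N) (unpickle j))).
have [cD DB] : (forall j, weakly_compact (D j)) /\
    (forall j x, D j x -> `|x| <= 1).
  split=> j; rewrite /D; set p := P _; have [cp pB] := svalP p => // x /pB.
  exact: (closed_unit_ballP x).1.
exists (0 |` \bigcup_j [set j.+1%:R^-1 *: x | x in D j]).
  apply: weakly_compact_shrinking => [j|j _ [x /DB x1 <-]].
    exact: weakly_compactZ.
  by rewrite normrZ gtr0_norm ?invr_gt0// ler_piMr.
move=> t t0 L cL; have [M LM] := weakly_compact_bounded cL.
(* [N] scales [L] into the ball, and [k] is fine enough for the error to be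
   at most [t] after scaling back. *)
pose N := (Num.truncn M).+1.
have MN : M <= N%:R by apply/ltW; exact: truncnS_gt.
have N0 : 0 < N%:R :> R by rewrite ltr0n.
have tN0 : 0 < t / N%:R by rewrite divr_gt0.
have [k _ /(_ k (leqnn k))/= ktN] := near_infty_natSinv_lt (PosNum tN0).
have L'B : [set N%:R^-1 *: x | x in L] `<=` closed_ball (0 : X) 1.
  move=> _ [x /LM xM <-]; apply/closed_unit_ballP.
  by rewrite normrZ gtr0_norm ?invr_gt0// ler_pdivrMl// mulr1 (le_trans xM).
pose L' := wcompact_ball_of (@weakly_compactZ R X L N%:R^-1 cL) L'B.
pose n := f (e k) L'.
have L'D := PP (k, n) L' (leqnn _).
pose j := pickle (k, n).
exists (N * j.+1)%N => x Lx; apply/fattenP => //.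
have /L'D/fattenP[//|a Pa xa] : sval L' (N%:R^-1 *: x) by exists x.
have Da : D j a by rewrite /D /j pickleK.
exists (N%:R *: a).
  exists (j.+1%:R^-1 *: a); first by right; exists j => //; exists a.
  by rewrite natrM scalerA mulfK.
have -> : x - N%:R *: a = N%:R *: (N%:R^-1 *: x - a).
  by rewrite scalerBr scalerA mulfV ?gt_eqF// scale1r.
rewrite normrZ gtr0_norm// -ler_pdivlMl// mulrC.
exact: le_trans xa (ltW ktN).
Qed.

Theorem theorem3p13 (R : realType) (X : completeNormedModType R) :
  (reflexive_space X <-> tukey_equiv (AK X) (asym_of_poset 'I_1)) /\
  (SWCG X /\ ~ reflexive_space X <-> tukey_equiv (AK X) (asym_of_poset nat)).
Proof.
split; split.
- by move=> refl; split; [exact: AK_tukey_le_point|exact: point_tukey_le_AK].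
- by move=> [/reflexive_of_tukey].
- by move=> [sX nrefl]; split; [exact: AK_tukey_le_nat|exact: nat_tukey_le_AK].
- by move=> [/SWCG_of_tukey sX /nonreflexive_of_tukey].
Qed.
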